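(* The control objective function $f:P^+\to\mathbb{R}_+$ of the stochastic power system described in the context is Lipschitz continuous on $P^+$.
   Context: $\mathbb{R}_+$ denotes the nonnegative reals, $\mathbb{Z}_n=\{1,\dots,n\}$, $A(k)$ is the $k$-th row of the matrix $A$, and $e_i$ is the $i$-th unit vector. Network data: a connected graph $G=(V,E)$ with $n_V$ vertices and $n_E$ edges and incidence matrix $B\in\mathbb{R}^{n_V\times n_E}$ (for the $k$-th edge $(i_k,j_k)$ the $k$-th column has $+1$ in row $i_k$, $-1$ in row $j_k$, zeros elsewhere); diagonal matrices $M\in\mathbb{R}^{n_V\times n_V}$ (strictly positive diagonal), $D\in\mathbb{R}^{n_V\times n_V}$ (nonnegative diagonal), $K_2\in\mathbb{R}^{n_V\times n_V}$ (nonnegative diagonal), $W\in\mathbb{R}^{n_E\times n_E}$ (strictly positive diagonal). Vertices $1,\dots,n^+$ ($n^+\ge 2$) are power supply nodes, vertices $n^++1,\dots,n_V$ are demand nodes. Given are $p^{+,max}\in\mathbb{R}_+^{n^+}$, $p^-\in\mathbb{R}_+^{n_V-n^+}$ with $p^-_{sum}=\sum_i p_i^->0$ and $\sum_{i=1}^{n^+}p_i^{+,max}\ge p^-_{sum}$, and a parameter $r>0$. Domain: $P^+=\{p_s\in\mathbb{R}_+^{n^+-1} : b_1\le A_1p_s,\ p_s\le b_2\}$ (componentwise), where $b_1(i)=p_{sum}^--p_{n^+}^{+,max}-\cdots-p_{i+1}^{+,max}$, $b_2(i)=p_i^{+,max}$, and $A_1\in\mathbb{R}^{(n^+-1)\times(n^+-1)}$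 has $A_1(i,j)=1$ if $i\ge j$ and $0$ otherwise. Let $L=BWB^\top$ with Moore–Penrose inverse $L^\dagger$, $A=B^\top L^\dagger[e_1-e_{n^+},\dots,e_{n^+-1}-e_{n^+}]\in\mathbb{R}^{n_E\times(n^+-1)}$, $b=B^\top L^\dagger[e_{n^++1}-e_{n^+},\dots,e_{n_V}-e_{n^+}](-p^-)\in\mathbb{R}^{n_E}$. Standing assumption: $|A(k)p_s+b_k|<1$ for all $p_s\in P^+$, $k\in\mathbb{Z}_{n_E}$. Set $f_{as,k}(p_s)=\arcsin(|A(k)p_s+b_k|)$. Standard deviations: let $W(p_s)=W\,\mathrm{diag}(\cos(\arcsin(Ap_s+b)))$ and let $U(p_s)\in\mathbb{R}^{n_V\times n_V}$ be orthogonal such that $U(p_s)^\top M^{-1/2}BW(p_s)B^\top M^{-1/2}U(p_s)$ is diagonal with first diagonal entry $0$. For a matrix $X$ with $n_V$ columns let $X([2:n_V])$ be the matrix of its columns $2,\dots,n_V$. Put (writing $U=U(p_s)$) $$J_d(p_s)=\begin{bmatrix}0_{(n_V-1)\times(n_V-1)} & [\,0_{(n_V-1)\times1}\ \ I_{n_V-1}\,]\\ -(U^\top M^{-1/2}BW(p_s)B^\top M^{-1/2}U)([2:n_V]) & -U^\top M^{-1}DU\end{bmatrix},$$ $$K_d(p_s)=\begin{bmatrix}0_{(n_V-1)\times n_V}\\ U^\top M^{-1/2}K_2\end{bmatrix},\quad C_d(p_s)=[\,(B^\top M^{-1/2}U)([2:n_V])\ \ 0_{n_E\times n_V}\,].$$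 Standing assumption: $J_d(p_s)$ is Hurwitz for all $p_s\in P^+$. Let $Q(p_s)$ be the unique solution of $J_dQ+QJ_d^\top+K_dK_d^\top=0$ and $\sigma_k(p_s)=\big((C_dQC_d^\top)(k,k)\big)^{1/2}$, assumed strictly positive on $P^+$. Control objective function: $f_k(p_s)=f_{as,k}(p_s)+r\,\sigma_k(p_s)$ and $f(p_s)=\max_{k\in\mathbb{Z}_{n_E}}f_k(p_s)$. *)

(* Defs.v *)
From mathcomp Require Import all_boot all_order all_algebra.
From mathcomp Require Import all_classical all_reals all_analysis.
From mathcomp Require Import complex.
Set Implicit Arguments.
Unset Strict Implicit.
Unset Printing Implicit Defensive.
Import Order.TTheory GRing.Theory Num.Theory.
Import numFieldNormedType.Exports.
Local Open Scope classical_set_scope.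
Local Open Scope ring_scope.

Definition is_moore_penrose (R : realType) (m n : nat)
    (A : 'M[R]_(m, n)) (X : 'M[R]_(n, m)) : Prop :=
  [/\ A *m X *m A = A, X *m A *m X = X,
      (A *m X)^T = A *m X & (X *m A)^T = X *m A].

(* Never takes the default value 0: see [moore_penroseP] and
   [moore_penrose_unique]. *)
Definition moore_penrose (R : realType) (m n : nat)
    (A : 'M[R]_(m, n)) : 'M[R]_(n, m) :=
  xget 0 [set X | is_moore_penrose A X].

Lemma gram_unitmx (R : realType) (m n : nat) (C : 'M[R]_(m, n)) :
  row_free C -> C *m C^T \in unitmx.
Proof.
move=> Cf; rewrite -row_free_unit; apply: inj_row_free => v vC.
suff w0 : v *m C = 0 by apply: (row_free_inj Cf); rewrite w0 mul0mx.
have : (v *m C) *m (v *m C)^T = 0.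
  by rewrite trmx_mul mulmxA -(mulmxA v) vC mul0mx.
move=> /matrixP/(_ 0 0); rewrite !mxE => s0.
apply/rowP => j; rewrite [RHS]mxE; apply/eqP; rewrite -sqrf_eq0 expr2.
have /psumr_eq0P : forall l, true -> 0 <= (v *m C) 0 l * (v *m C)^T l 0.
  by move=> l _; rewrite [_^T _ _]mxE -expr2 sqr_ge0.
by move=> /(_ s0 j isT); rewrite [_^T _ _]mxE => ->.
Qed.

Lemma moore_penroseP (R : realType) (m n : nat) (A : 'M[R]_(m, n)) :
  is_moore_penrose A (moore_penrose A).
Proof.
apply: (@xgetPex _ 0 [set X | is_moore_penrose A X]).
suff {A} main r (C : 'M[R]_(r, m)) (S : 'M[R]_(r, n)) : row_free C ->
    row_free S -> exists X, is_moore_penrose (C^T *m S) X.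
  rewrite -(mulmx_base A) -[col_base A]trmxK; apply: main.
    by rewrite /row_free mxrank_tr; apply: col_base_full.
  exact: row_base_free.
move=> /gram_unitmx CU /gram_unitmx SU; set A := _ *m _.
have defA : A = C^T *m S by [].
exists (S^T *m invmx (S *m S^T) *m (invmx (C *m C^T) *m C)).
set X := _ *m _ *m _.
have AX : A *m X = C^T *m invmx (C *m C^T) *m C.
  by rewrite defA /X !mulmxA -(mulmxA C^T) -(mulmxA C^T) mulmxV // mulmx1.
have XA : X *m A = S^T *m invmx (S *m S^T) *m S.
  rewrite defA /X -!mulmxA; congr (_ *m (_ *m _)).
  by rewrite (mulmxA C) mulmxA mulVmx // mul1mx.
split.
- rewrite AX defA -!mulmxA; congr (_ *m _).
  by rewrite (mulmxA C) mulmxA mulVmx // mul1mx.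
- rewrite XA /X -!mulmxA; congr (_ *m _).
  by rewrite (mulmxA S) (mulmxA (invmx _)) mulVmx // mul1mx.
- by rewrite AX !trmx_mul trmx_inv trmx_mul trmxK mulmxA.
- by rewrite XA !trmx_mul trmx_inv trmx_mul trmxK mulmxA.
Qed.

Lemma moore_penrose_unique (R : realType) (m n : nat) (A : 'M[R]_(m, n))
    (X Y : 'M[R]_(n, m)) :
  is_moore_penrose A X -> is_moore_penrose A Y -> X = Y.
Proof.
move=> [X1 X2 X3 X4] [Y1 Y2 Y3 Y4].
have eqAX : A *m X = A *m Y.
  rewrite -X3 -{1}Y1 -(mulmxA (A *m Y)) trmx_mul X3 Y3.
  by rewrite mulmxA X1.
have eqXA : X *m A = Y *m A.
  rewrite -X4 -{1}Y1 -(mulmxA A) mulmxA trmx_mul X4 Y4.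
  by rewrite -mulmxA (mulmxA A) X1.
by rewrite -X2 eqXA -mulmxA eqAX mulmxA Y2.
Qed.

Definition hurwitz (R : realType) (n : nat) (J : 'M[R]_n) : Prop :=
  forall z : R[i],
    eigenvalue (map_mx (real_complex R) J) z -> complex.Re z < 0.

(* The solution exists and is unique when J is Hurwitz. *)
Definition lyapunov (R : realType) (n q : nat)
    (J : 'M[R]_n) (K : 'M[R]_(n, q)) : 'M[R]_n :=
  xget 0 [set Q | J *m Q + Q *m J^T + K *m K^T = 0].

Definition cols_from2 (R : realType) (m n : nat)
    (X : 'M[R]_(m, n.+1)) : 'M[R]_(m, n) :=
  colsub (lift ord0) X.

(* Indices start at 0, and n = n^+ - 1, d = n_V - n^+, e = n_E, so that
   n_V - 1 = n + d. Vertices 0, ..., n are the supply nodes (n is the paper's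
   vertex n^+) and n+1, ..., n+d the demand nodes. Each diagonal matrix is
   given by its diagonal. *)
Record power_system (R : realType) (n d e : nat) := PowerSystem {
  edge : 'I_e -> 'I_(n + d).+1 * 'I_(n + d).+1;
  mass : 'rV[R]_((n + d).+1);
  damping : 'rV[R]_((n + d).+1);
  noise : 'rV[R]_((n + d).+1);
  weight : 'rV[R]_e;
  pmax : 'cV[R]_n.+1;
  pdem : 'cV[R]_d;
  n_gt0 : (2 <= n.+1)%N;
  edge_loopless : forall k, (edge k).1 != (edge k).2;
  edge_simple : injective (fun k => [set (edge k).1; (edge k).2]%SET);
  edge_connected : forall u v : 'I_(n + d).+1,
    connect (fun x y => [exists k, (edge k == (x, y)) || (edge k == (y, x))])
      u v;
  mass_gt0 : forall i, 0 < mass 0 i;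
  damping_ge0 : forall i, 0 <= damping 0 i;
  noise_ge0 : forall i, 0 <= noise 0 i;
  weight_gt0 : forall k, 0 < weight 0 k;
  pmax_ge0 : forall i, 0 <= pmax i 0;
  pdem_ge0 : forall i, 0 <= pdem i 0;
  pdem_sum_gt0 : 0 < \sum_i pdem i 0;
  pdem_le_pmax : \sum_i pdem i 0 <= \sum_i pmax i 0
}.

Section System.
Context (R : realType) (n d e : nat) (net : power_system R n d e).
Local Notation N := (n + d)%N.

Definition inc_mx : 'M[R]_(N.+1, e) :=
  \matrix_(i, k) ((i == (edge net k).1)%:R - (i == (edge net k).2)%:R).

Definition M_inv : 'M[R]_N.+1 := invmx (diag_mx (mass net)).
Definition M_invsqrt : 'M[R]_N.+1 :=
  diag_mx (map_mx (fun x => (Num.sqrt x)^-1) (mass net)).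
Definition D_mx : 'M[R]_N.+1 := diag_mx (damping net).
Definition K2_mx : 'M[R]_N.+1 := diag_mx (noise net).
Definition W_mx : 'M[R]_e := diag_mx (weight net).

Definition b1 : 'cV[R]_n :=
  \col_i (\sum_j pdem net j 0 - \sum_(j < n.+1 | (i < j)%N) pmax net j 0).
Definition b2 : 'cV[R]_n := \col_i pmax net (widen_ord (leqnSn n) i) 0.
Definition A1 : 'M[R]_n := \matrix_(i, j) (j <= i)%N%:R.

Definition supply_domain : set 'cV[R]_n :=
  [set p : 'cV[R]_n | forall i, [/\ 0 <= p i 0, b1 i 0 <= (A1 *m p) i 0 & p i 0 <= b2 i 0]].

Definition L_mx : 'M[R]_N.+1 := inc_mx *m W_mx *m inc_mx^T.

Definition supply_mx : 'M[R]_(N.+1, n) :=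
  \matrix_(i, j) ((i == j :> nat)%:R - (i == n :> nat)%:R).
Definition demand_mx : 'M[R]_(N.+1, d) :=
  \matrix_(i, j) ((i == n.+1 + j :> nat)%N%:R - (i == n :> nat)%:R).

Definition A_mx : 'M[R]_(e, n) := inc_mx^T *m moore_penrose L_mx *m supply_mx.
Definition b_vec : 'cV[R]_e :=
  inc_mx^T *m moore_penrose L_mx *m demand_mx *m (- pdem net).

Definition line_flow (p : 'cV[R]_n) : 'cV[R]_e := A_mx *m p + b_vec.

Definition f_as (k : 'I_e) (p : 'cV[R]_n) : R := asin `|line_flow p k 0|.

Definition Wp_mx (p : 'cV[R]_n) : 'M[R]_e :=
  W_mx *m diag_mx (\row_k cos (asin (line_flow p k 0))).

Definition scaled_laplacian (p : 'cV[R]_n) : 'M[R]_N.+1 :=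
  M_invsqrt *m inc_mx *m Wp_mx p *m inc_mx^T *m M_invsqrt.

Definition diagonalizes (p : 'cV[R]_n) (U : 'M[R]_N.+1) : Prop :=
  [/\ U^T *m U = 1%:M,
      is_diag_mx (U^T *m scaled_laplacian p *m U) &
      (U^T *m scaled_laplacian p *m U) ord0 ord0 = 0].

Definition J_d (p : 'cV[R]_n) (U : 'M[R]_N.+1) : 'M[R]_(N + N.+1) :=
  block_mx
    0 (row_mx (0 : 'M[R]_(N, 1)) 1%:M)
    (- cols_from2 (U^T *m scaled_laplacian p *m U))
    (- (U^T *m M_inv *m D_mx *m U)).

Definition K_d (U : 'M[R]_N.+1) : 'M[R]_(N + N.+1, N.+1) :=
  col_mx 0 (U^T *m M_invsqrt *m K2_mx).

Definition C_d (U : 'M[R]_N.+1) : 'M[R]_(e, N + N.+1) :=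
  row_mx (cols_from2 (inc_mx^T *m M_invsqrt *m U)) 0.

Definition sigma (k : 'I_e) (p : 'cV[R]_n) (U : 'M[R]_N.+1) : R :=
  Num.sqrt ((C_d U *m lyapunov (J_d p U) (K_d U) *m (C_d U)^T) k k).

Definition f_line (r : R) (k : 'I_e) (p : 'cV[R]_n) (U : 'M[R]_N.+1) : R :=
  f_as k p + r * sigma k p U.

(* The functions [f_line] are nonnegative on [supply_domain] for r > 0, and
   connectedness forces e > 0, so starting the maximum at 0 is harmless. *)
Definition control_objective (r : R) (U : 'cV[R]_n -> 'M[R]_N.+1)
    (p : 'cV[R]_n) : R :=
  \big[Num.max/0]_(k < e) f_line r k p (U p).

End System.

(* Main.v *)
(* On a compact set, Lipschitz functions are closed under sums, products and
   maxima, under inverses when they do not vanish, under square roots when they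
   are positive, and under arcsin when their values lie in the open interval
   (-1, 1). So it suffices to build f from the line flows by these operations.
   The basis U(p) need not depend continuously on p, but it can be replaced by
   U(p0) for a fixed p0: the kernel of the scaled Laplacian is the line spanned
   by M^(1/2) 1 for every p, because the graph is connected and all line weights
   are positive, so U(p)^T U(p0) fixes the first axis up to a sign and conjugates
   the two Lyapunov equations without changing the deviations sigma_k. With U
   fixed, J_d depends Lipschitz continuously on p, and the vectorised Lyapunov
   operator, invertible because J_d is Hurwitz, is inverted by Cramer's rule. *)

Require Import Defs.
From mathcomp Require Import all_boot all_order all_algebra.
From mathcomp Require Import all_classical all_reals all_analysis.
From mathcomp Require Import complex ring lra.
Set Implicit Arguments.
Unset Strict Implicit.
Unset Printing Implicit Defensive.
Import Order.TTheory GRing.Theory Num.Theory.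
Import numFieldNormedType.Exports.
Local Open Scope classical_set_scope.
Local Open Scope ring_scope.

(** * Lipschitz functions on a set and the operations preserving them *)

Definition lip (R : realType) (V : normedModType R) (A : set V) (f : V -> R) :=
  exists2 k : R, 0 <= k &
    forall x y, A x -> A y -> `|f x - f y| <= k * `|x - y|.

Section LipschitzCalculus.
Context (R : realType) (V : normedModType R) (A : set V).
Implicit Types f g : V -> R.

(** [[lipschitz _ | _ in _]] asks for the bound with all sufficiently large constants; any [M >= k]
    inherits it from [k]. *)
Lemma lipP f : lip A f -> [lipschitz (f x : R^o) | x in A].
Proof.
move=> [k k0 fk]; rewrite /lipschitz_on.
apply: (@filterS _ _ _ [set M | k <= M]).
  move=> M kM [x y] /= [Ax Ay]; apply: (le_trans (fk x y Ax Ay)).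
  exact: ler_wpM2r.
by apply: nbhs_pinfty_ge; rewrite num_real.
Qed.

Lemma eq_lip f g : {in A, f =1 g} -> lip A f -> lip A g.
Proof.
move=> fg [k k0 fk]; exists k => // x y Ax Ay.
by rewrite -!fg ?inE //; apply: fk.
Qed.

(** The set [S] confines the values of [f], as needed for square root and arcsine, whose derivatives
    are unbounded. *)
Lemma lip_comp (S : set R) f (g : R -> R) : lip A f ->
  (forall x, A x -> S (f x)) ->
  (exists2 k : R, 0 <= k & forall s t, S s -> S t -> `|g s - g t| <= k * `|s - t|) ->
  lip A (fun x => g (f x)).
Proof.
move=> [k k0 fk] fS [l l0 gl]; exists (l * k) => [|x y Ax Ay].
  exact: mulr_ge0.
apply: (le_trans (gl _ _ (fS x Ax) (fS y Ay))).
by rewrite -mulrA; apply: ler_wpM2l => //; apply: fk.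
Qed.

Lemma lip_cst (c : R) : lip A (fun=> c).
Proof. by exists 0 => // x y _ _; rewrite subrr normr0 mul0r. Qed.

Lemma lipD f g : lip A f -> lip A g -> lip A (fun x => f x + g x).
Proof.
move=> [k k0 fk] [l l0 gl]; exists (k + l) => [|x y Ax Ay].
  exact: addr_ge0.
have -> : f x + g x - (f y + g y) = (f x - f y) + (g x - g y) by ring.
by rewrite (le_trans (ler_normD _ _)) // mulrDl lerD ?fk ?gl.
Qed.

Lemma lipN f : lip A f -> lip A (fun x => - f x).
Proof.
move=> [k k0 fk]; exists k => // x y Ax Ay.
by rewrite -opprD normrN fk.
Qed.

Lemma lip_norm f : lip A f -> lip A (fun x => `|f x|).
Proof.
move=> [k k0 fk]; exists k => // x y Ax Ay.
exact: le_trans (ler_dist_dist _ _) (fk x y Ax Ay).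
Qed.

Lemma lip_sum (I : Type) (r : seq I) (P : pred I) (F : I -> V -> R) :
  (forall i, lip A (F i)) -> lip A (fun x => \sum_(i <- r | P i) F i x).
Proof.
move=> FA; elim: r => [|i r IHr].
  by apply: eq_lip (lip_cst 0) => x _; rewrite big_nil.
case Pi : (P i); last by apply: eq_lip IHr => x _; rewrite big_cons Pi.
by apply: eq_lip (lipD (FA i) IHr) => x _; rewrite big_cons Pi.
Qed.

Lemma lipZ (c : R) f : lip A f -> lip A (fun x => c * f x).
Proof.
move=> [k k0 fk]; exists (`|c| * k) => [|x y Ax Ay].
  exact: mulr_ge0.
by rewrite -mulrBr normrM -mulrA ler_wpM2l ?fk.
Qed.

(** Uses max(f, g) = (f + g + |f - g|) / 2. *)
Lemma lip_max f g : lip A f -> lip A g -> lip A (fun x => Num.max (f x) (g x)).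
Proof.
move=> fA gA.
have := lipZ 2^-1 (lipD (lipD fA gA) (lip_norm (lipD fA (lipN gA)))).
by apply: eq_lip => x _; rewrite maxr_absE mulrC.
Qed.

Lemma lip_bigmax (I : Type) (r : seq I) (F : I -> V -> R) :
  (forall i, lip A (F i)) -> lip A (fun x => \big[Num.max/0]_(i <- r) F i x).
Proof.
move=> FA; elim: r => [|i r IHr].
  by apply: eq_lip (lip_cst 0) => x _; rewrite big_nil.
by apply: eq_lip (lip_max (FA i) IHr) => x _; rewrite big_cons.
Qed.

Lemma lip_continuous f : lip A f -> {within A, continuous f}.
Proof.
move=> [k k0 fk]; apply/subspace_continuousP => x Ax.
apply/cvgrPdist_le => eps eps0; rewrite near_withinE.
(* Dividing by [k + 1] covers the case [k = 0]. *)
have k1 : 0 < k + 1 by rewrite ltr_wpDl.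
have := (@cvgr_dist_le _ _ _ (nbhs x) _ id x) _ (eps / (k + 1)).
move=> /(_ _ (fun A => id)); rewrite divr_gt0 // => /(_ isT).
apply: filterS => y /= xy Ay; apply: (le_trans (fk x y Ax Ay)).
move: xy; rewrite ler_pdivlMr // mulrDr mulr1 mulrC; apply: le_trans.
by rewrite lerDl.
Qed.

Hypothesis cA : compact A.

Lemma lip_bounded f : lip A f ->
  exists2 M : R, 0 <= M & forall x, A x -> `|f x| <= M.
Proof.
move=> fA; have [->|/set0P A0] := eqVneq A set0; first by exists 0.
have [c _ fc] := compact_EVT_max A0 cA (lip_continuous (lip_norm fA)).
by exists `|f c| => // x Ax; apply: fc; rewrite inE.
Qed.

(** The minimum is attained, hence positive. This is where compactness makes pointwise conditions
    uniform. *)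
Lemma lip_gt0_bounded f : lip A f -> (forall x, A x -> 0 < f x) ->
  exists2 c : R, 0 < c & forall x, A x -> c <= f x.
Proof.
move=> fA f0; have [->|/set0P A0] := eqVneq A set0; first by exists 1.
have [c /set_mem Ac fc] := compact_EVT_min A0 cA (lip_continuous fA).
by exists (f c) => [|x Ax]; [apply: f0|apply: fc; rewrite inE].
Qed.

Lemma lipM f g : lip A f -> lip A g -> lip A (fun x => f x * g x).
Proof.
move=> fA gA; have [a a0 fa] := lip_bounded fA; have [b b0 gb] := lip_bounded gA.
move: fA gA => [k k0 fk] [l l0 gl]; exists (k * b + a * l) => [|x y Ax Ay].
  by rewrite addr_ge0 ?mulr_ge0.
have -> : f x * g x - f y * g y = (f x - f y) * g x + f y * (g x - g y) by ring.
rewrite (le_trans (ler_normD _ _)) // !normrM mulrDl lerD //.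
  by rewrite mulrAC ler_pM ?fk ?gb.
by rewrite -mulrA ler_pM ?fa ?gl.
Qed.

Lemma lip_prod (I : Type) (r : seq I) (P : pred I) (F : I -> V -> R) :
  (forall i, lip A (F i)) -> lip A (fun x => \prod_(i <- r | P i) F i x).
Proof.
move=> FA; elim: r => [|i r IHr].
  by apply: eq_lip (lip_cst 1) => x _; rewrite big_nil.
case Pi : (P i); last by apply: eq_lip IHr => x _; rewrite big_cons Pi.
by apply: eq_lip (lipM (FA i) IHr) => x _; rewrite big_cons Pi.
Qed.

Lemma lipV f : lip A f -> (forall x, A x -> f x != 0) -> lip A (fun x => (f x)^-1).
Proof.
move=> fA f0; have [x Ax|c c0 cf] := lip_gt0_bounded (lip_norm fA).
  by rewrite normr_gt0 f0.
move: fA => [k k0 fk]; exists (k / c ^+ 2) => [|x y Ax Ay].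
  by rewrite divr_ge0 ?exprn_ge0 // ltW.
have -> : (f x)^-1 - (f y)^-1 = (f y - f x) / (f x * f y).
  by field; rewrite !f0.
rewrite normrM distrC normfV normrM [leRHS]mulrAC; apply: ler_pM => //.
- exact: fk.
rewrite lef_pV2 ?posrE ?exprn_gt0 ?mulr_gt0 ?normr_gt0 ?f0 // expr2.
by rewrite ler_pM ?cf // ltW.
Qed.

(** Since |s - t| = |sqrt s - sqrt t| (sqrt s + sqrt t) and the last factor is at least sqrt c, the
    constant 1 / sqrt c works. *)
Lemma lip_sqrt f : lip A f -> (forall x, A x -> 0 < f x) ->
  lip A (fun x => Num.sqrt (f x)).
Proof.
move=> fA f0; have [c c0 cf] := lip_gt0_bounded fA f0.
apply: (@lip_comp [set t | c <= t]) fA cf _.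
have sc : 0 < Num.sqrt c by rewrite sqrtr_gt0.
exists (Num.sqrt c)^-1 => [|s t /= cs ct]; first by rewrite invr_ge0 ltW.
have s0 : 0 <= s := le_trans (ltW c0) cs.
have t0 : 0 <= t := le_trans (ltW c0) ct.
have -> : `|s - t| =
    `|Num.sqrt s - Num.sqrt t| * `|Num.sqrt s + Num.sqrt t|.
  by rewrite -normrM -subr_sqr !sqr_sqrtr.
rewrite mulrC ler_pdivlMr // ler_wpM2l //.
rewrite ger0_norm ?addr_ge0 ?sqrtr_ge0 //.
by rewrite -[leLHS]addr0 lerD ?sqrtr_ge0 // ler_wsqrtr.
Qed.

(** Compactness keeps |f| <= 1 - c for some c > 0. There the derivative 1 / sqrt(1 - x^2) is at most
    1 / sqrt c, and the mean value theorem applies. *)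
Lemma lip_asin f : lip A f -> (forall x, A x -> `|f x| < 1) ->
  lip A (fun x => asin (f x)).
Proof.
move=> fA f1; have [x Ax|c c0 cf] :=
  lip_gt0_bounded (lipD (lip_cst 1) (lipN (lip_norm fA))).
  by rewrite subr_gt0 f1.
apply: (@lip_comp [set t | `|t| <= 1 - c]) fA _ _ => [x /cf|].
  by move=> /=; rewrite lerBrDl -lerBrDr.
have bnd (t : R) : `|t| <= 1 - c -> -1 < t < 1.
  by move=> tc; rewrite -ltr_norml; lra.
(* 1 - t^2 >= 1 - (1 - c)^2 = c (2 - c) >= c, because 0 <= |t| <= 1 - c forces c <= 1. *)
have sq (t : R) : `|t| <= 1 - c -> c <= 1 - t ^+ 2.
  move=> tc; rewrite -[t ^+ 2]real_normK ?num_real //; have := normr_ge0 t; nra.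
have mono (s t : R) : s <= t -> `|s| <= 1 - c -> `|t| <= 1 - c ->
    `|asin s - asin t| <= (Num.sqrt c)^-1 * `|s - t|.
  move=> st sc tc.
  have inc x : s <= x <= t -> `|x| <= 1 - c.
    by move: sc tc; rewrite !ler_norml; lra.
  have [||x] := @MVT_segment R (@asin R) (fun x => (Num.sqrt (1 - x ^+ 2))^-1) s t st.
  - move=> x; rewrite in_itv /= => /andP[sx xt]; apply: is_derive1_asin.
    by apply/bnd/inc; rewrite !ltW.
  - apply: continuous_in_subspaceT => x /set_mem; rewrite /= in_itv /= => xst.
    by apply: continuous_asin; rewrite ?bnd ?inc.
  rewrite in_itv /= => xst; rewrite distrC => ->; rewrite normrM distrC.
  apply: ler_wpM2r => //; rewrite ger0_norm ?invr_ge0 ?sqrtr_ge0 //.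
  have := sq _ (inc _ xst) => cx.
  rewrite lef_pV2 ?posrE ?sqrtr_gt0 ?ler_wsqrtr //; lra.
exists (Num.sqrt c)^-1; first by rewrite invr_ge0 sqrtr_ge0.
move=> s t sc tc; have [st|/ltW st] := leP s t; first exact: mono.
by rewrite distrC [X in _ * X]distrC mono.
Qed.

End LipschitzCalculus.

(** * Sylvester and Lyapunov equations *)

(* With p the characteristic polynomial of A, 0 = p(A) X = X p(B), and p(B) is
   invertible because no root of p is an eigenvalue of B. *)
Lemma sylvester_eq0 (F : closedFieldType) (m n : nat) (A : 'M[F]_m)
    (B : 'M[F]_n) (X : 'M[F]_(m, n)) :
  (forall z, eigenvalue A z -> ~~ eigenvalue B z) ->
  A *m X = X *m B -> X = 0.
Proof.
case: m n A B X => [|m] [|n] A B X AB AX; rewrite ?(flatmx0 X) ?(thinmx0 X) //.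
have hornerX (p : {poly F}) : horner_mx A p *m X = X *m horner_mx B p.
  elim/poly_ind: p => [|p c IHp]; first by rewrite !rmorph0 mul0mx mulmx0.
  rewrite !rmorphD !rmorphM /= !horner_mx_X !horner_mx_C mulmxDl mulmxDr.
  by rewrite -!mulmxE -mulmxA AX mulmxA IHp -mulmxA scalar_mxC.
have [s defA] := closed_field_poly_normal (char_poly A).
rewrite (monicP (char_poly_monic A)) scale1r in defA.
have := hornerX (char_poly A); rewrite Cayley_Hamilton mul0mx.
have : {in s, forall z, eigenvalue A z}.
  by move=> z zs; rewrite eigenvalue_root_char defA root_prod_XsubC.
(* The invertible factors [B - z%:M] are cancelled one root at a time. *)
rewrite defA => {defA hornerX}; elim: s => [|z s IHs] sA.
  by rewrite big_nil rmorph1 mulmx1.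
rewrite big_cons mulrC rmorphM rmorphB /= horner_mx_X horner_mx_C -mulmxE mulmxA.
have Bz : B - z%:M \in unitmx.
  have := AB z (sA z (mem_head _ _)).
  by rewrite negbK kermx_eq0 row_free_unit.
move=> /(congr1 (mulmxr (invmx (B - z%:M)))) /=; rewrite mul0mx mulmxK // => s0.
by apply: IHs => // w ws; apply: sA; rewrite inE ws orbT.
Qed.

Lemma eigenvalue_tr (F : fieldType) (n : nat) (A : 'M[F]_n) :
  eigenvalue A^T =1 eigenvalue A.
Proof.
move=> z; rewrite /eigenvalue /eigenspace !kermx_eq0 !row_free_unit.
by rewrite -(unitmx_tr (A - _)) linearB /= tr_scalar_mx.
Qed.

Section Lyapunov.
Context (R : realType).

(** The equation reads J X = X (-J^T). Over the complex numbers the eigenvalues of J have negative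
    real part and those of -J^T positive real part, so the spectra are disjoint. *)
Lemma hurwitz_lyapunov_inj (m : nat) (J X : 'M[R]_m) :
  hurwitz J -> J *m X + X *m J^T = 0 -> X = 0.
Proof.
move=> hJ /eqP; rewrite addr_eq0 -mulmxN => /eqP JX.
have := congr1 (map_mx (real_complex R)) JX; rewrite !map_mxM => JXC.
apply: (map_mx_inj (f := real_complex R)); rewrite map_mx0.
apply: sylvester_eq0 JXC => z /hJ z0; apply/negP => /eigenvalueP[v vJ v0].
have : eigenvalue (map_mx (real_complex R) J) (- z).
  rewrite -eigenvalue_tr.
  apply/eigenvalueP; exists v => //.
  by rewrite scaleNr -vJ map_mxN mulmxN opprK map_trmx.
by move=> /hJ; case: z z0 {vJ} => a b /=; lra.
Qed.

(** Matrix of Q |-> J Q + Q J^T on vectorised matrices, acting on row vectors from the right. *)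
Definition lyap_mx (m : nat) (J : 'M[R]_m) : 'M[R]_(m * m) :=
  lin_mulmx J + lin_mulmxr J^T.

Lemma mul_lyap_mx (m : nat) (J Q : 'M[R]_m) :
  mxvec Q *m lyap_mx J = mxvec (J *m Q + Q *m J^T).
Proof. by rewrite mulmxDr !mul_vec_lin /= linearD. Qed.

(** A square matrix with trivial kernel is invertible. Assuming injectivity instead of a Hurwitz [J]
    makes the lemma apply directly to conjugates of [J]. *)
Lemma lyap_mx_unit (m : nat) (J : 'M[R]_m) :
  (forall X : 'M[R]_m, J *m X + X *m J^T = 0 -> X = 0) -> lyap_mx J \in unitmx.
Proof.
move=> J_inj; rewrite -row_free_unit; apply: inj_row_free => v.
rewrite -[v]vec_mxK mul_lyap_mx => /(canRL mxvecK); rewrite linear0 => /J_inj ->.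
by rewrite linear0.
Qed.

Lemma lyapunov_solP (m q : nat) (J Q : 'M[R]_m) (K : 'M[R]_(m, q)) :
  lyap_mx J \in unitmx ->
  J *m Q + Q *m J^T + K *m K^T = 0 <->
  Q = - vec_mx (mxvec (K *m K^T) *m invmx (lyap_mx J)).
Proof.
move=> Ju; split=> [|->].
  move=> /eqP; rewrite addr_eq0 => /eqP /(congr1 mxvec).
  rewrite -mul_lyap_mx => /(canRL (mulmxK Ju)) /(canRL mxvecK) ->.
  by rewrite linearN /= mulNmx linearN.
apply/eqP; rewrite addr_eq0 -(can_eq mxvecK) -mul_lyap_mx !linearN /= vec_mxK.
by rewrite mulNmx mulmxKV.
Qed.

(** The explicit formula also proves existence, so [lyapunov] does not fall back on its default
    value. *)
Lemma lyapunovE (m q : nat) (J : 'M[R]_m) (K : 'M[R]_(m, q)) :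
  lyap_mx J \in unitmx ->
  lyapunov J K = - vec_mx (mxvec (K *m K^T) *m invmx (lyap_mx J)).
Proof.
move=> Ju; apply/lyapunov_solP => //.
apply: (@xgetPex _ 0 [set Q | J *m Q + Q *m J^T + K *m K^T = 0]).
by eexists; apply/lyapunov_solP.
Qed.

Lemma lyapunovP (m q : nat) (J Q : 'M[R]_m) (K : 'M[R]_(m, q)) :
  lyap_mx J \in unitmx ->
  J *m Q + Q *m J^T + K *m K^T = 0 <-> Q = lyapunov J K.
Proof. by move=> Ju; rewrite lyapunovE //; apply: lyapunov_solP. Qed.

(** X |-> T X T^T carries solutions of the homogeneous equation for T^T J T to solutions for J. *)
Lemma lyap_mx_conj_unit (m : nat) (T J : 'M[R]_m) :
  T^T *m T = 1%:M -> lyap_mx J \in unitmx -> lyap_mx (T^T *m J *m T) \in unitmx.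
Proof.
move=> TT Ju; have TT' := mulmx1C TT.
apply: lyap_mx_unit => X /(congr1 (fun Y => T *m Y *m T^T)).
rewrite mulmx0 mul0mx => JX.
have X0 : T *m X *m T^T = 0.
  apply: (can_inj mxvecK); apply: (can_inj (mulmxK Ju)).
  rewrite mul_lyap_mx linear0 mul0mx -(linear0 mxvec) -JX.
  rewrite !trmx_mul trmxK mulmxDr mulmxDl.
  by rewrite !mulmxA TT' mul1mx -!mulmxA TT' mulmx1.
move: X0 => /(congr1 (fun Y => T^T *m Y *m T)).
by rewrite mulmx0 mul0mx !mulmxA TT mul1mx -mulmxA TT mulmx1.
Qed.

Lemma lyapunov_conj (m q : nat) (T J : 'M[R]_m) (K : 'M[R]_(m, q)) :
  T^T *m T = 1%:M -> lyap_mx J \in unitmx ->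
  lyapunov (T^T *m J *m T) (T^T *m K) = T^T *m lyapunov J K *m T.
Proof.
move=> TT Ju; have TT' := mulmx1C TT; set Q := lyapunov J K.
have /(congr1 (fun Y => T^T *m Y *m T)) := (lyapunovP Q K Ju).2 erefl.
rewrite mulmx0 mul0mx => QE; apply/esym/lyapunovP; first exact: lyap_mx_conj_unit.
rewrite -QE !trmx_mul trmxK !mulmxDr !mulmxDl !mulmxA.
by rewrite -!(mulmxA _ T T^T) TT' !mulmx1.
Qed.

End Lyapunov.

(** * Matrix-valued maps that are Lipschitz entry by entry *)

Definition lipmx (R : realType) (V : normedModType R) (A : set V) (m n : nat)
  (F : V -> 'M[R]_(m, n)) := forall i j, lip A (fun x => F x i j).

Section LipschitzMatrix.
Context (R : realType) (V : normedModType R) (A : set V).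

Lemma lipmx_cst (m n : nat) (M : 'M[R]_(m, n)) : lipmx A (fun=> M).
Proof. by move=> i j; apply: lip_cst. Qed.

Lemma lipmxD (m n : nat) (F G : V -> 'M[R]_(m, n)) :
  lipmx A F -> lipmx A G -> lipmx A (fun x => F x + G x).
Proof.
by move=> FA GA i j; apply: eq_lip (lipD (FA i j) (GA i j)) => x _; rewrite mxE.
Qed.

Lemma lipmxN (m n : nat) (F : V -> 'M[R]_(m, n)) :
  lipmx A F -> lipmx A (fun x => - F x).
Proof. by move=> FA i j; apply: eq_lip (lipN (FA i j)) => x _; rewrite mxE. Qed.

Lemma lipmx_tr (m n : nat) (F : V -> 'M[R]_(m, n)) :
  lipmx A F -> lipmx A (fun x => (F x)^T).
Proof. by move=> FA i j; apply: eq_lip (FA j i) => x _; rewrite mxE. Qed.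

Lemma lipmx_block (m1 m2 n1 n2 : nat) (F1 : V -> 'M[R]_(m1, n1))
    (F2 : V -> 'M[R]_(m1, n2)) (F3 : V -> 'M[R]_(m2, n1))
    (F4 : V -> 'M[R]_(m2, n2)) :
  lipmx A F1 -> lipmx A F2 -> lipmx A F3 -> lipmx A F4 ->
  lipmx A (fun x => block_mx (F1 x) (F2 x) (F3 x) (F4 x)).
Proof.
move=> A1 A2 A3 A4 i j; case: (split_ordP i) (split_ordP j) => i' -> [] j' ->.
- by apply: eq_lip (A1 i' j') => x _; rewrite block_mxEul.
- by apply: eq_lip (A2 i' j') => x _; rewrite block_mxEur.
- by apply: eq_lip (A3 i' j') => x _; rewrite block_mxEdl.
- by apply: eq_lip (A4 i' j') => x _; rewrite block_mxEdr.
Qed.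

Lemma lipmx_colsub (m n p : nat) (g : 'I_p -> 'I_n) (F : V -> 'M[R]_(m, n)) :
  lipmx A F -> lipmx A (fun x => colsub g (F x)).
Proof. by move=> FA i j; apply: eq_lip (FA i (g j)) => x _; rewrite mxE. Qed.

Lemma lipmx_diag (n : nat) (F : V -> 'rV[R]_n) :
  lipmx A F -> lipmx A (fun x => diag_mx (F x)).
Proof.
move=> FA i j; have [->|ij] := eqVneq i j.
  by apply: eq_lip (FA 0 j) => x _; rewrite mxE eqxx.
by apply: eq_lip (lip_cst A 0) => x _; rewrite mxE (negPf ij).
Qed.

Lemma lipmx_mxvec (m n : nat) (F : V -> 'M[R]_(m, n)) :
  lipmx A F -> lipmx A (fun x => mxvec (F x)).
Proof.
move=> FA i j; rewrite (ord1 i); case/mxvec_indexP: j => j k.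
by apply: eq_lip (FA j k) => x _; rewrite mxvecE.
Qed.

Lemma lipmx_vec_mx (m n : nat) (F : V -> 'rV[R]_(m * n)) :
  lipmx A F -> lipmx A (fun x => vec_mx (F x)).
Proof. by move=> FA i j; apply: eq_lip (FA 0 (mxvec_index i j)) => x _; rewrite mxE. Qed.

Hypothesis cA : compact A.

Lemma lipmxM (m n p : nat) (F : V -> 'M[R]_(m, n)) (G : V -> 'M[R]_(n, p)) :
  lipmx A F -> lipmx A G -> lipmx A (fun x => F x *m G x).
Proof.
move=> FA GA i j.
apply: eq_lip (lip_sum (index_enum _) xpredT
  (fun k => lipM cA (FA i k) (GA k j))) => x _.
by rewrite mxE.
Qed.

Lemma lip_det (n : nat) (F : V -> 'M[R]_n) :
  lipmx A F -> lip A (fun x => \det (F x)).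
Proof.
by move=> FA; apply: lip_sum => s; apply: lipZ; apply: lip_prod.
Qed.

(** Cramer's rule: the inverse is the adjugate over the determinant, and cofactors are signed
    determinants of minors. *)
Lemma lipmx_inv (n : nat) (F : V -> 'M[R]_n) :
  lipmx A F -> (forall x, A x -> F x \in unitmx) ->
  lipmx A (fun x => invmx (F x)).
Proof.
move=> FA Fu i j.
have adjA : lip A (fun x => (\adj (F x)) i j).
  have minorA : lipmx A (fun x => row' j (col' i (F x))).
    by move=> k l; apply: eq_lip (FA (lift j k) (lift i l)) => x _; rewrite !mxE.
  apply: eq_lip (lipZ ((-1) ^+ (j + i)) (lip_det minorA)) => x _.
  by rewrite mxE.
have detF x : A x -> \det (F x) != 0 by move=> /Fu; rewrite unitmxE unitfE.
apply: eq_lip (lipM cA (lipV cA (lip_det FA) detF) adjA) => x /set_mem Ax.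
by rewrite /invmx Fu // [RHS]mxE.
Qed.

Lemma lipmx_lyapunov (m q : nat) (J : V -> 'M[R]_m) (K : V -> 'M[R]_(m, q)) :
  lipmx A J -> lipmx A K -> (forall x, A x -> lyap_mx (J x) \in unitmx) ->
  lipmx A (fun x => lyapunov (J x) (K x)).
Proof.
move=> JA KA Ju.
(* Row [i] of the operator matrix is the vectorised image of the [i]-th matrix unit. *)
have LA : lipmx A (fun x => lyap_mx (J x)).
  move=> i j; have := lipmx_mxvec (lipmxD
    (lipmxM JA (lipmx_cst (vec_mx (delta_mx 0 i))))
    (lipmxM (lipmx_cst (vec_mx (delta_mx 0 i))) (lipmx_tr JA))) 0 j.
  apply: eq_lip => x _.
  by rewrite -mul_lyap_mx vec_mxK -rowE mxE.
have := lipmxN (lipmx_vec_mx (lipmxM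
  (lipmx_mxvec (lipmxM KA (lipmx_tr KA))) (lipmx_inv LA Ju))).
move=> H i j; apply: eq_lip (H i j) => x /set_mem Ax.
by rewrite lyapunovE ?Ju.
Qed.

End LipschitzMatrix.

(** * Change of basis in the linearised system *)

(** The factors T T^T cancel, which is why the output covariance ignores an orthogonal change of
    state coordinates. *)
Lemma congr_mx_orthogonal (R : realType) (m n : nat) (C : 'M[R]_(m, n))
    (T Q : 'M[R]_n) :
  T *m T^T = 1%:M -> C *m T *m (T^T *m Q *m T) *m (C *m T)^T = C *m Q *m C^T.
Proof.
move=> TT; rewrite trmx_mul !mulmxA -(mulmxA C) TT mulmx1.
by rewrite -(mulmxA _ T) TT mulmx1.
Qed.

Section FirstVectorFixed.
Context (R : realType) (n : nat) (V : 'M[R]_n.+1).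
Hypotheses (Vl : forall i, V (lift ord0 i) ord0 = 0)
           (Vr : forall j, V ord0 (lift ord0 j) = 0).

(** The hypotheses make [V] block diagonal with a 1 x 1 first block; [V2] is the other block. *)
Local Notation V2 := (row' ord0 (col' ord0 V)).

Lemma cols_from2_mul (m : nat) (X : 'M[R]_(m, n.+1)) :
  cols_from2 (X *m V) = cols_from2 X *m V2.
Proof.
apply/matrixP => i j; rewrite !mxE big_ord_recl Vr mulr0 add0r.
by apply: eq_bigr => k _; rewrite !mxE.
Qed.

Lemma row_mx01_mul :
  (row_mx (0 : 'M[R]_(n, 1)) 1%:M : 'M[R]_(n, n.+1)) *m V =
  V2 *m row_mx (0 : 'M[R]_(n, 1)) 1%:M.
Proof.
have rE i k : (row_mx (0 : 'M[R]_(n, 1)) 1%:M : 'M[R]_(n, n.+1)) i k =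
    (k == lift ord0 i)%:R.
  rewrite [LHS]mxE; case: (split_ordP (k : 'I_(1 + n))) => l ->.
    by rewrite mxE (ord1 l) -val_eqE.
  by rewrite mxE -[in RHS]val_eqE /= /bump /= !add1n eqSS eq_sym.
apply/(@matrixP R n n.+1) => i j; rewrite !mxE (bigD1 (lift ord0 i)) //= rE eqxx mul1r.
rewrite big1 ?addr0 => [|k /negPf ki]; last by rewrite rE ki mul0r.
case: (unliftP ord0 j) => [l ->|->].
  rewrite (bigD1 l) //= rE eqxx mulr1 big1 ?addr0 ?mxE // => k kl.
  by rewrite rE (inj_eq lift_inj) eq_sym (negPf kl) mulr0.
by rewrite Vl big1 // => k _; rewrite rE mulr0.
Qed.

Lemma row'_col'_orthogonal : V^T *m V = 1%:M -> V2^T *m V2 = 1%:M.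
Proof.
move=> VV; apply/matrixP => i j.
have := congr1 (fun M : 'M[R]_n.+1 => M (lift ord0 i) (lift ord0 j)) VV.
rewrite !mxE big_ord_recl Vr mulr0 add0r (inj_eq lift_inj) => <-.
by apply: eq_bigr => k _; rewrite !mxE.
Qed.

End FirstVectorFixed.

Section System.
Context (R : realType) (n d e : nat) (net : power_system R n d e).
Local Notation N := (n + d)%N.
Implicit Types (p : 'cV[R]_n) (U : 'M[R]_N.+1).

Lemma Wp_mxE p : Wp_mx net p =
  diag_mx (\row_k (weight net 0 k * cos (asin (line_flow net p k 0)))).
Proof. by rewrite /Wp_mx mulmx_diag; congr diag_mx; apply/rowP => k; rewrite !mxE. Qed.

Lemma weight_cos_gt0 p k : `|line_flow net p k 0| < 1 ->
  0 < weight net 0 k * cos (asin (line_flow net p k 0)).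
Proof.
rewrite ltr_norml => /andP[l1 l2]; rewrite mulr_gt0 ?weight_gt0 // cos_asin ?ltW //.
by rewrite sqrtr_gt0; nra.
Qed.

(* Zero energy on every line makes M^(-1/2) u constant along the edges. *)
Lemma diagonalizes_col0 p U : (forall k, `|line_flow net p k 0| < 1) ->
  diagonalizes net p U -> exists c, forall i, U i ord0 = Num.sqrt (mass net 0 i) * c.
Proof.
move=> flow1 [UU _ S00]; pose Y := (inc_mx net)^T *m M_invsqrt net *m U.
(* In the form Y^T W(p) Y, the zero first diagonal entry is a sum of positive weights times squares,
   so column 0 of [Y] vanishes. *)
have SE : U^T *m scaled_laplacian net p *m U = Y^T *m Wp_mx net p *m Y.
  by rewrite /Y /scaled_laplacian !trmx_mul trmxK tr_diag_mx !mulmxA.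
have Y0 k : Y k ord0 = 0.
  move: S00; rewrite SE Wp_mxE mxE => S00.
  have F0 l : (Y^T *m diag_mx (\row_k (weight net 0 k *
      cos (asin (line_flow net p k 0))))) ord0 l * Y l ord0 =
    weight net 0 l * cos (asin (line_flow net p l 0)) * Y l ord0 ^+ 2.
    by rewrite mul_mx_diag !mxE; ring.
  have /psumr_eq0P : forall l, true -> 0 <= (Y^T *m diag_mx (\row_k (weight net 0 k *
      cos (asin (line_flow net p k 0))))) ord0 l * Y l ord0.
    by move=> l _; rewrite F0 mulr_ge0 ?sqr_ge0 // ltW // weight_cos_gt0.
  move=> /(_ S00 k isT); rewrite F0 => /eqP; rewrite mulf_eq0 sqrf_eq0.
  by rewrite gt_eqF ?weight_cos_gt0 //= => /eqP.
pose x i := (Num.sqrt (mass net 0 i))^-1 * U i ord0.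
(* Row [k] of B^T x is the difference of [x] across edge [k]. *)
have xedge k : x (edge net k).1 = x (edge net k).2.
  apply/eqP; rewrite -subr_eq0 -(Y0 k) /Y -mulmxA mxE.
  under eq_bigr do rewrite mul_diag_mx !mxE mulrBl.
  rewrite big_split /= sumrN.
  rewrite (bigD1 (edge net k).1) //= eqxx mul1r big1 ?addr0; last first.
    by move=> i /negPf ->; rewrite mul0r.
  rewrite (bigD1 (edge net k).2) //= eqxx mul1r big1 ?addr0 //.
  by move=> i /negPf ->; rewrite mul0r.
(* Induction along a path from [i] to [j], whose edges may be traversed in either orientation. *)
have xc i j : x i = x j.
  have /connectP[s] := edge_connected net i j.
  elim: s i => [|l s IHs] i /=; first by move=> _ ->.
  move=> /andP[/existsP[k kil] ls] jE; rewrite -(IHs l) //.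
  by case/orP: kil => /eqP; have := xedge k => + kE; rewrite kE.
exists (x ord0) => i; rewrite (xc ord0 i) mulVKf //.
by rewrite gt_eqF // sqrtr_gt0 mass_gt0.
Qed.

(** The first columns are parallel, so this entry is c' / c times an off-diagonal entry of U^T U =
    1. The first column of [U] has norm 1, hence [c] is nonzero. *)
Lemma orthogonal_col0 U U' (c c' : R) (s : 'I_N.+1 -> R) :
  U^T *m U = 1%:M -> (forall i, U i ord0 = s i * c) ->
  (forall i, U' i ord0 = s i * c') ->
  forall i, (U^T *m U') (lift ord0 i) ord0 = 0.
Proof.
move=> UU Uc Uc' i.
have c0 : c != 0.
  apply/eqP => c0; have := congr1 (fun M : 'M[R]_N.+1 => M ord0 ord0) UU.
  rewrite !mxE big1 => [|k _]; first by move=> /esym/eqP; rewrite oner_eq0.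
  by rewrite Uc c0 !mulr0.
have := congr1 (fun M : 'M[R]_N.+1 => M (lift ord0 i) ord0) UU.
rewrite !mxE /= => /(congr1 (fun t => t * (c' / c))).
rewrite mul0r mulr_suml => S0; rewrite -[RHS]S0.
by apply: eq_bigr => k _; rewrite !mxE Uc Uc'; field.
Qed.

Section ChangeOfBasis.
Context (p : 'cV[R]_n) (U U' : 'M[R]_N.+1).
Hypotheses (flow1 : forall k, `|line_flow net p k 0| < 1)
  (Up : diagonalizes net p U) (UU' : U'^T *m U' = 1%:M)
  (U'0 : exists c, forall i, U' i ord0 = Num.sqrt (mass net 0 i) * c).

(** [U'] is any orthogonal matrix whose first column is parallel to M^(1/2) 1, so U(p0) qualifies at
    every p. [V] is the transition matrix. *)
Let V := U^T *m U'.
(** The state has N position coordinates, the first mode being removed, and N + 1 velocities; hence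
    the two blocks. *)
Let T : 'M[R]_(N + N.+1) := block_mx (row' ord0 (col' ord0 V)) 0 0 V.

Let UU : U^T *m U = 1%:M. Proof. by case: Up. Qed.

Let U'E : U' = U *m V.
Proof. by rewrite /V mulmxA (mulmx1C UU) mul1mx. Qed.

Let Vl i : V (lift ord0 i) ord0 = 0.
Proof.
have [c Uc] := diagonalizes_col0 flow1 Up; have [c' Uc'] := U'0.
exact: orthogonal_col0 UU Uc Uc' i.
Qed.

Let Vr i : V ord0 (lift ord0 i) = 0.
Proof.
have [c Uc] := diagonalizes_col0 flow1 Up; have [c' Uc'] := U'0.
(* The same argument with [U] and [U'] exchanged, read on the transpose. *)
by have := orthogonal_col0 UU' Uc' Uc i; rewrite -{1}(trmxK U) -trmx_mul mxE.
Qed.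

Let VV : V^T *m V = 1%:M.
Proof. by rewrite trmx_mul trmxK -/V -mulmxA -U'E. Qed.

Let TT : T^T *m T = 1%:M.
Proof.
rewrite tr_block_mx !trmx0 mulmx_block !mulmx0 !mul0mx !addr0 !add0r.
by rewrite VV row'_col'_orthogonal // -scalar_mx_block.
Qed.

Let conjE (X : 'M[R]_N.+1) : U'^T *m X *m U' = V^T *m (U^T *m X *m U) *m V.
Proof. by rewrite U'E trmx_mul !mulmxA. Qed.

Lemma J_d_conj : J_d net p U' = T^T *m J_d net p U *m T.
Proof.
rewrite /T tr_block_mx !trmx0 /J_d !mulmx_block !mulmx0 !mul0mx !addr0 !add0r.
rewrite mul0mx; congr block_mx.
(* Upper right block: V2^T [0 I] V = V2^T V2 [0 I] = [0 I]. *)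
- apply: etrans (mulmxA _ _ _).
  apply: etrans (congr1 (mulmx _) (esym (row_mx01_mul Vl))).
  by rewrite mulmxA (row'_col'_orthogonal Vr VV) mul1mx.
- rewrite conjE (cols_from2_mul Vr) /cols_from2 -mulmx_colsub.
  by rewrite mulmxN mulNmx.
- rewrite -!(mulmxA _ _ (D_mx net)) conjE.
  by rewrite mulmxN mulNmx.
Qed.

Lemma K_d_conj : K_d net U' = T^T *m K_d net U.
Proof.
rewrite /T tr_block_mx !trmx0 /K_d mul_block_col !mulmx0 !mul0mx !addr0 !add0r.
by rewrite {1}U'E trmx_mul !mulmxA.
Qed.

Lemma C_d_conj : C_d net U' = C_d net U *m T.
Proof.
rewrite /T /C_d mul_row_block !mulmx0 !mul0mx !addr0; congr row_mx.
by rewrite {1}U'E mulmxA cols_from2_mul.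
Qed.

Lemma lyap_mx_J_d_unit :
  lyap_mx (J_d net p U) \in unitmx -> lyap_mx (J_d net p U') \in unitmx.
Proof. by rewrite J_d_conj; apply: lyap_mx_conj_unit. Qed.

(** All three system matrices transform by the same orthogonal [T], so Q becomes T^T Q T and C Q C^T
    is unchanged. *)
Lemma sigma_change_basis k : lyap_mx (J_d net p U) \in unitmx ->
  sigma net k p U' = sigma net k p U.
Proof.
move=> Ju; rewrite /sigma J_d_conj K_d_conj C_d_conj lyapunov_conj //.
by rewrite (congr_mx_orthogonal _ _ (mulmx1C TT)).
Qed.

End ChangeOfBasis.

End System.

(** * Lipschitz continuity on the supply domain *)

Section MatrixNorm.
Context (R : realType) (m n : nat).

Lemma normr_coord_le (M : 'M[R]_(m, n)) i j : `|M i j| <= `|M|.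
Proof.
rewrite [leRHS]mx_normrE.
by apply: (le_bigmax_cond _ (fun ij => `|M ij.1 ij.2|) (j := (i, j))).
Qed.

Lemma normr_mx_le (M : 'M[R]_(m, n)) (c : R) :
  0 <= c -> (forall i j, `|M i j| <= c) -> `|M| <= c.
Proof. by move=> c0 Mc; rewrite [leLHS]mx_normrE; apply: bigmax_le. Qed.

Lemma lipmx_id (A : set 'M[R]_(m, n)) : lipmx A id.
Proof.
move=> i j; exists 1 => // x y _ _.
by rewrite mul1r; have := normr_coord_le (x - y) i j; rewrite !mxE.
Qed.

End MatrixNorm.

Lemma nonexpansive_continuous (R : realType) (V W : normedModType R)
    (f : V -> W) :
  (forall x y, `|f x - f y| <= `|x - y|) -> continuous f.
Proof.
move=> fd x; apply/cvgrPdist_le => eps eps0.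
have := @cvgr_dist_le _ _ _ (nbhs x) _ id x _ eps eps0.
move=> /(_ _ (fun A => id)); apply: filterS => y; exact: le_trans.
Qed.

Lemma trmx_continuous (R : realType) (m n : nat) :
  continuous (fun M : 'M[R]_(m, n) => M^T).
Proof.
apply: nonexpansive_continuous => M P; apply: normr_mx_le => // i j.
by rewrite -linearB mxE normr_coord_le.
Qed.

Lemma lip_setT_continuous (R : realType) (V : normedModType R) (f : V -> R) :
  lip setT f -> continuous f.
Proof.
move=> /lip_continuous/subspace_continuousP fc x.
apply: cvg_trans (fc x I) => P /=; rewrite /fmap /within /= => fP.
by apply: (filterS (F := nbhs x) _ fP) => y; apply.
Qed.

(** Heine-Borel for row vectors, carried over by the continuity of transposition. *)
Lemma bounded_closed_compact_cV (R : realType) (n : nat) (A : set 'cV[R]_n)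
    (c : R) :
  (forall x, A x -> forall i, `|x i 0| <= c) -> closed A -> compact A.
Proof.
move=> Ac Acl; have -> : A = trmx @` (trmx @^-1` A : set 'rV[R]_n).
  apply/seteqP; split=> [x Ax|_ [x /= Ax <-]] //.
  by exists x^T; rewrite /= trmxK.
apply: continuous_compact.
  by apply: continuous_subspaceT; exact: trmx_continuous.
apply: bounded_closed_compact.
  exists `|c|; split; first exact: num_real.
  move=> M cM x /Ac xc; apply: normr_mx_le => [|i j].
    exact: le_trans (ltW cM).
  rewrite (ord1 i) (le_trans _ (ltW cM)) // (le_trans _ (ler_norm c)) //.
  by have := xc j; rewrite mxE.
by apply: preimage_closed => // x _; exact: trmx_continuous.
Qed.

Section Domain.
Context (R : realType) (n d e : nat) (net : power_system R n d e).

(** Coordinates lie between 0 and [b2], so the sum of all |b2_i| bounds each of them; closedness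
    comes from preimages of closed half-lines. *)
Lemma supply_domain_compact : compact (supply_domain net).
Proof.
apply: (@bounded_closed_compact_cV _ _ _ (\sum_i `|b2 net i 0|)).
  move=> p Ap i; have [p0 _ pb] := Ap i; rewrite ger0_norm //.
  rewrite (le_trans pb) // (bigD1 i) //= (le_trans (ler_norm _)) //.
  by rewrite lerDl sumr_ge0.
have -> : supply_domain net = \bigcap_(i in [set: 'I_n])
    ((fun p : 'cV[R]_n => p i 0) @^-1` [set t | 0 <= t] `&`
     ((fun p : 'cV[R]_n => (A1 R n *m p) i 0) @^-1` [set t | b1 net i 0 <= t] `&`
      (fun p : 'cV[R]_n => p i 0) @^-1` [set t | t <= b2 net i 0])).
  apply/seteqP; split=> p Ap i; first by move=> _; have [] := Ap i.
  by have [? []] := Ap i I.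
have closed_pre (f : 'cV[R]_n -> R) D : lip setT f -> closed D -> closed (f @^-1` D).
  move=> /lip_setT_continuous cf; apply: preimage_closed => p _; exact: cf.
apply: closed_bigI => i _; apply: closedI; first last.
  apply: closedI; apply: closed_pre; last 2 first.
  - exact: lipmx_id.
  - exact: closed_le.
  - apply: eq_lip (lip_sum (index_enum _) xpredT
      (fun j => lipZ (A1 R n i j) (@lipmx_id _ _ _ setT j 0))) => p _.
    by rewrite mxE.
  - exact: closed_ge.
apply: closed_pre; [exact: lipmx_id | exact: closed_ge].
Qed.

Let cA := supply_domain_compact.
Hypothesis flow1 :
  forall p k, supply_domain net p -> `|line_flow net p k 0| < 1.

Lemma line_flow_lip : lipmx (supply_domain net) (line_flow net).
Proof.
apply: lipmxD (lipmx_cst _ _).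
exact: lipmxM (lipmx_cst _ _) (lipmx_id _).
Qed.

Lemma f_as_lip k : lip (supply_domain net) (f_as net k).
Proof.
apply: lip_asin => // [|p Ap]; first exact/lip_norm/line_flow_lip.
by rewrite normr_id flow1.
Qed.

(** Rewriting cos(arcsin x) as sqrt(1 - x^2), with positive radicand, reduces the claim to
    [lip_sqrt]. *)
Lemma Wp_mx_lip : lipmx (supply_domain net) (Wp_mx net).
Proof.
apply: lipmxM => //; first exact: lipmx_cst.
apply: lipmx_diag => i k.
have fk := line_flow_lip k 0.
have pos p : supply_domain net p -> 0 < 1 - line_flow net p k 0 ^+ 2.
  by move=> /flow1 -/(_ k); rewrite ltr_norml => /andP[]; nra.
apply: eq_lip (lip_sqrt cA (lipD (lip_cst _ 1) (lipN (lipM cA fk fk))) pos).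
move=> p /set_mem /flow1 -/(_ k); rewrite ltr_norml => /andP[l1 l2].
by rewrite mxE cos_asin ?ltW.
Qed.

(** With [U] fixed, [p] enters only through W(p) in the lower left block. *)
Lemma J_d_lip (U : 'M[R]_((n + d).+1)) :
  lipmx (supply_domain net) (fun p => J_d net p U).
Proof.
apply: lipmx_block; [exact: lipmx_cst | exact: lipmx_cst | |exact: lipmx_cst].
apply/lipmxN/lipmx_colsub.
apply: lipmxM (lipmx_cst _ _) => //; apply: lipmxM => //.
  exact: lipmx_cst.
do 2![apply: lipmxM => //; last exact: lipmx_cst].
by apply: lipmxM => //; [exact: lipmx_cst | exact: Wp_mx_lip].
Qed.

Lemma sigma_lip (U : 'M[R]_((n + d).+1)) k :
  (forall p, supply_domain net p -> lyap_mx (J_d net p U) \in unitmx) ->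
  (forall p, supply_domain net p -> 0 < sigma net k p U) ->
  lip (supply_domain net) (fun p => sigma net k p U).
Proof.
(* Positivity of [sigma] is positivity of the radicand. *)
move=> Ju s0; apply: lip_sqrt => // [|p /s0]; last by rewrite sqrtr_gt0.
apply: (lipmxM _ _ _) => //; last exact: lipmx_cst.
apply: lipmxM => //; first exact: lipmx_cst.
apply: lipmx_lyapunov => //; [exact: J_d_lip | exact: lipmx_cst].
Qed.

End Domain.

Unset Implicit Arguments.

Theorem proposition3p5 (R : realType) (n d e : nat)
    (net : power_system R n d e) (r : R) (U : 'cV[R]_n -> 'M[R]_((n + d).+1))
    (r_gt0 : 0 < r)
    (flow_lt1 : forall p k, supply_domain net p -> `|line_flow net p k 0| < 1)
    (U_diag : forall p, supply_domain net p -> diagonalizes net p (U p))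
    (J_hurwitz : forall p, supply_domain net p -> hurwitz (J_d net p (U p)))
    (sigma_gt0 : forall p k, supply_domain net p -> 0 < sigma net k p (U p)) :
  [lipschitz (control_objective net r U p : R^o) | p in supply_domain net].
Proof.
(* A nonempty domain provides the base point [p0] whose basis is used throughout. *)
have [->|/set0P[p0 Ap0]] := eqVneq (supply_domain net) set0.
  exact: lipschitz_set0.
have U00 := diagonalizes_col0 (fun k => flow_lt1 p0 k Ap0) (U_diag p0 Ap0).
have UU0 : (U p0)^T *m U p0 = 1%:M by case: (U_diag p0 Ap0).
have Ju p : supply_domain net p -> lyap_mx (J_d net p (U p)) \in unitmx.
  move=> Ap; apply: lyap_mx_unit => X; apply: hurwitz_lyapunov_inj.
  exact: J_hurwitz.
(* Invertibility of the Lyapunov operator is carried from the basis U(p) to U(p0). *)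
have Ju0 p : supply_domain net p -> lyap_mx (J_d net p (U p0)) \in unitmx.
  move=> Ap; have flow_p k := flow_lt1 p k Ap.
  exact: lyap_mx_J_d_unit flow_p (U_diag p Ap) UU0 U00 (Ju p Ap).
have sigmaE p k : supply_domain net p ->
    sigma net k p (U p0) = sigma net k p (U p).
  move=> Ap; have flow_p k' := flow_lt1 p k' Ap.
  exact: sigma_change_basis flow_p (U_diag p Ap) UU0 U00 _ (Ju p Ap).
apply: lipP; apply: lip_bigmax => k.
apply: lipD; first exact: f_as_lip.
(* The Lipschitz bound passes from U(p0) to U(p), positivity of [sigma] from U(p) to U(p0). *)
apply/lipZ/(eq_lip _ (sigma_lip (k := k) flow_lt1 Ju0 _)).
  by move=> p /set_mem Ap; apply: sigmaE.
by move=> p Ap; rewrite sigmaE ?sigma_gt0.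
Qed.
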